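(* Let $k\ge 1$ and $d\ge 0$ be integers. Let $N$ be the number of monomials of degree $d$ in $x_1,\dots,x_k$, let $\phi:\mathcal{P}_k^d\to\mathbb{F}_2^N$ be a linear isomorphism, and let $M$ be the matrix over $\mathbb{F}_2$ with $N$ rows whose columns are the vectors $\phi(h)$ for all $h$ in $$\mathcal{H}_d(\mathcal{P}_k)=\{\,Sq^{2^j}(m)\;\mid\; j\ge 0,\ m\text{ is a monomial in }\mathcal{P}_k,\ \deg(m)=d-2^j\,\}.$$ Then $$\dim_{\mathbb{F}_2}(Q\mathcal{P}_k)_d=\dim_{\mathbb{F}_2}\left(\mathcal{P}_k^d\big/(\mathcal{A}^+\mathcal{P}_k)_d\right)=\binom{d+k-1}{k-1}-\operatorname{rank}(M).$$
   Context: $\mathcal{P}_k=\mathbb{F}_2[x_1,\dots,x_k]$ is the polynomial algebra in $k$ variables, each of degree $1$, over the field $\mathbb{F}_2$, graded by degree; $\mathcal{P}_k^d$ is the $\mathbb{F}_2$-vector space of homogeneous polynomials of degree $d$ in $\mathcal{P}_k$ (together with $0$). The mod-2 Steenrod algebra $\mathcal{A}$ is generated by the Steenrod squares $Sq^i$, $i\ge 0$, and acts on $\mathcal{P}_k$ in the standard way: $Sq^i$ is $\mathbb{F}_2$-linear and raises degree by $i$; $Sq^0$ is the identity; $Sq^1(x_j)=x_j^2$ and $Sq^i(x_j)=0$ for $i>1$; $Sq^i(1)=0$ for $i>0$; and the Cartan formula $Sq^n(fg)=\sum_{i+j=n}Sq^i(f)Sq^j(g)$ holds. $\mathcal{A}^+$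 denotes the augmentation ideal of $\mathcal{A}$. A polynomial $f\in\mathcal{P}_k^d$ is hit if it lies in $\mathcal{A}^+\mathcal{P}_k$, i.e. if it can be written as a finite sum $f=\sum_{i>0}Sq^i(g_i)$ with $g_i\in\mathcal{P}_k^{d-i}$. The set of all hit polynomials of degree $d$ is a vector subspace of $\mathcal{P}_k^d$, denoted $(\mathcal{A}^+\mathcal{P}_k)_d$. The graded quotient space is $Q\mathcal{P}_k=\mathbb{F}_2\otimes_{\mathcal{A}}\mathcal{P}_k\cong\mathcal{P}_k/\mathcal{A}^+\mathcal{P}_k$, and $(Q\mathcal{P}_k)_d=\mathcal{P}_k^d/(\mathcal{A}^+\mathcal{P}_k)_d$ is its degree-$d$ component. *)

(* Defs.v *)
From HB Require Import structures.
From mathcomp Require Import all_boot all_order all_algebra.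
From mathcomp Require Export mpoly.
Set Implicit Arguments.
Unset Strict Implicit.
Unset Printing Implicit Defensive.
Import GRing.Theory.
Local Open Scope ring_scope.
Local Open Scope quotient_scope.

(* The quotient V / U of a finite-dimensional space by a subspace: the        *)
(* additive quotient group of ring_quotient, equipped with the structure of a *)
(* finite-dimensional K-space for which \pi_(vquot U) : V -> V / U is linear. *)
Definition vquot (K : fieldType) (vT : vectType K) (U : {vspace vT}) : Type :=
  Quotient.quot U.

Section VectorQuotient.
Import VectorInternalTheory.
Variables (K : fieldType) (vT : vectType K) (U : {vspace vT}).
Local Notation Q := (vquot U).

HB.instance Definition _ := Choice.on Q.
HB.instance Definition _ := ZmodQuotient.on Q.

Lemma vquot_eqE (x y : vT) : (\pi_Q x == \pi_Q y) = (x - y \in U).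
Proof. by rewrite piE. Qed.

Lemma vquot_piD (x y : vT) : \pi_Q (x + y) = \pi_Q x + \pi_Q y.
Proof. exact: pi_addr. Qed.

Definition vquot_scale (a : K) (q : Q) : Q := \pi_Q (a *: repr q).

Lemma vquot_piZ a (x : vT) : \pi_Q (a *: x) = vquot_scale a (\pi_Q x).
Proof.
by apply/eqP; rewrite vquot_eqE -scalerBr memvZ // -vquot_eqE reprK.
Qed.

Fact vquot_scaleA a b q : vquot_scale a (vquot_scale b q) = vquot_scale (a * b) q.
Proof. by rewrite {2}/vquot_scale -vquot_piZ scalerA. Qed.

Fact vquot_scale1 : left_id 1 vquot_scale.
Proof. by move=> q; rewrite /vquot_scale scale1r reprK. Qed.

Fact vquot_scaleDr : right_distributive vquot_scale +%R.
Proof.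
move=> a p q; rewrite -[p]reprK -[q]reprK -vquot_piD -!vquot_piZ.
by rewrite scalerDr vquot_piD.
Qed.

Fact vquot_scaleDl q : {morph vquot_scale^~ q : a b / a + b}.
Proof. by move=> a b; rewrite /vquot_scale scalerDl vquot_piD. Qed.

HB.instance Definition _ := GRing.Zmodule_isLmodule.Build K Q
  vquot_scaleA vquot_scale1 vquot_scaleDr vquot_scaleDl.

Lemma vquot_pi_linear : linear (\pi_Q : vT -> Q).
Proof. by move=> a x y; rewrite vquot_piD vquot_piZ. Qed.

(* V / U is identified with the complement U^C. *)
Fact vquot_vect_axiom : vector_axiom (\dim (U^C)%VS) Q.
Proof.
pose W := (U^C)%VS; pose pr := daddv_pi W U.
have WU0 : (W :&: U = 0)%VS by rewrite capvC capv_compl.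
have WUT x : x \in (W + U)%VS by rewrite addvC addv_complf memvf.
have prB x : x - pr x \in U.
  by rewrite -{1}(daddv_pi_add WU0 (WUT x)) addrAC subrr add0r memv_pi.
have prU x : x \in U -> pr x = 0.
  move=> Ux; have := daddv_pi_add WU0 (WUT x).
  by rewrite (daddv_pi_id (capv_compl U) Ux) -[RHS]add0r => /addIr.
pose S := subvs_of W.
pose f (q : Q) : S := vsproj W (pr (repr q)).
have fpi x : f (\pi_Q x) = vsproj W (pr x).
  rewrite /f; congr (vsproj W _); apply/subr0_eq.
  by rewrite -linearB /=; apply: prU; rewrite -vquot_eqE reprK.
pose g (s : S) : Q := \pi_Q (vsval s).
have fg : cancel g f.
  by move=> s; rewrite /g fpi /pr daddv_pi_id ?subvsP // vsvalK.
have gf : cancel f g.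
  move=> q; rewrite -[q]reprK fpi /g vsprojK ?memv_pi //.
  by apply/esym/eqP; rewrite vquot_eqE.
have flin : linear f.
  move=> a p q; rewrite -[p]reprK -[q]reprK -vquot_pi_linear !fpi.
  by rewrite !linearP.
exists (fun q => v2r (f q) : 'rV[K]_(\dim W)).
  by move=> a p q; rewrite flin linearP.
exists (fun r : 'rV[K]_(\dim W) => g (r2v (r : 'rV[K]_(dim S)))) => x.
  by rewrite v2rK gf.
by rewrite fg r2vK.
Qed.

HB.instance Definition _ := Lmodule_hasFinDim.Build K Q vquot_vect_axiom.

End VectorQuotient.

Record steenrod_action (k : nat) := SteenrodAction {
  Sq :> nat -> {linear {mpoly 'F_2[k]} -> {mpoly 'F_2[k]}};
  Sq_homog : forall i d (f : {mpoly 'F_2[k]}),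
    f \is d.-homog -> Sq i f \is (d + i).-homog;
  Sq0 : forall f, Sq 0 f = f;
  Sq1X : forall j, Sq 1 'X_j = 'X_j ^+ 2;
  SqX : forall i j, (1 < i)%N -> Sq i 'X_j = 0;
  Sq_1 : forall i, (0 < i)%N -> Sq i 1 = 0;
  Sq_cartan : forall n f g,
    Sq n (f * g) = \sum_(i < n.+1) Sq i f * Sq (n - i)%N g
}.

(* Such an action exists: Sq^i f is the coefficient of T^i in the image of f  *)
(* under the algebra morphism P_k -> P_k[T] mapping x_j to x_j + x_j^2 T.     *)
Section Existence.
Variable k : nat.
Local Notation P := {mpoly 'F_2[k]}.

Definition total_square : P -> {poly P} :=
  mmap (polyC \o @mpolyC k 'F_2) (fun j => ('X_j : P)%:P + ('X_j ^+ 2 : P)%:P * 'X).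

Definition std_square (i : nat) (f : P) : P := (total_square f)`_i.

Fact std_square_linear i : linear (std_square i).
Proof.
move=> a f g; rewrite /std_square /total_square mmapD mmapZ coefD.
by rewrite coefCM mul_mpolyC.
Qed.

HB.instance Definition _ i :=
  GRing.isLinear.Build 'F_2 P P _ (std_square i) (std_square_linear i).

Fact total_squareM f g : total_square (f * g) = total_square f * total_square g.
Proof. exact: rmorphM. Qed.

Fact total_square1 : total_square 1 = 1.
Proof. exact: rmorph1. Qed.

Fact total_squareX j : total_square 'X_j = ('X_j : P)%:P + ('X_j ^+ 2 : P)%:P * 'X.
Proof. by rewrite /total_square mmapX mmap1U. Qed.

Fact std_squareX i j :
  std_square i 'X_j = 'X_j *+ (i == 0)%N + 'X_j ^+ 2 *+ (i == 1)%N.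
Proof.
rewrite /std_square total_squareX coefD coefC coefCM coefX mulr_natr.
by case: i => [|i].
Qed.

Fact std_square_1 i : std_square i 1 = (i == 0)%:R.
Proof. by rewrite /std_square total_square1 coef1. Qed.

Fact std_square_cartan n f g :
  std_square n (f * g) = \sum_(i < n.+1) std_square i f * std_square (n - i) g.
Proof. by rewrite /std_square total_squareM coefM. Qed.

Fact monomial_ind (T : 'X_{1..k} -> Prop) :
  T 0%MM -> (forall m j, T m -> T (U_(j) + m)%MM) -> forall m, T m.
Proof.
move=> T0 TS m; have [n] := ubnP (mdeg m); elim: n m => // n IHn m lt_m_n.
have [/eqP|nz_m] := eqVneq (mdeg m) 0%N; first by rewrite mdeg_eq0 => /eqP ->.
have [j mj] : exists j, m j != 0%N.
  apply/existsP; apply: contraNT nz_m; rewrite negb_exists => /forallP m0.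
  by rewrite mdegE big1 // => j _; apply/eqP; rewrite -[_ == _]negbK m0.
have leUm : (U_(j) <= m)%MM by rewrite lep1mP.
rewrite -(submK leUm) addmC; apply/TS/IHn.
by move: lt_m_n; rewrite -{1}(submK leUm) mdegD mdeg1 addn1.
Qed.

Fact std_square0 f : std_square 0 f = f.
Proof.
elim/mpolyind: f => [|c m p _ _ IHp]; first by rewrite linear0.
rewrite std_square_linear IHp; congr (_ *: _ + _).
elim/monomial_ind: m {p IHp} => [|m j IHm]; first by rewrite mpolyX0 std_square_1.
rewrite mpolyXD std_square_cartan big_ord_recl big_ord0 addr0 /= subn0 IHm.
by rewrite std_squareX addr0.
Qed.

Fact std_square_homog i d (f : P) :
  f \is d.-homog -> std_square i f \is (d + i).-homog.
Proof.
have homX (m : 'X_{1..k}) n : std_square n 'X_[m] \is (mdeg m + n).-homog.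
  elim/monomial_ind: m n => [|m j IHm] n.
    rewrite mpolyX0 std_square_1 mdeg0 add0n.
    by case: n => [|n]; [exact: dhomog1 | exact: dhomog0].
  rewrite mpolyXD std_square_cartan rpred_sum // => a _.
  have -> : (mdeg (U_(j) + m) + n = (1 + a) + (mdeg m + (n - a)))%N.
    by rewrite mdegD mdeg1 addnACA subnKC // -ltnS.
  apply: dhomogM; last exact: IHm.
  have homXj : 'X_j \is [in 'F_2[k], 1.-homog] by rewrite dhomogX /= mdeg1.
  rewrite std_squareX; case: (val a) => [|[|b]]; rewrite /= ?addr0 ?add0r //.
  - by rewrite mulr1n expr2; exact: (dhomogM homXj homXj).
  - by rewrite mulr0n; exact: dhomog0.
move=> /dhomogP homf; rewrite [f]mpolyE raddf_sum /=.
rewrite big_seq rpred_sum // => m /homf <-.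
by rewrite linearZ; apply/rpredZ/homX.
Qed.

Definition std_steenrod_action : steenrod_action k.
Proof.
apply: (@SteenrodAction k (fun i => std_square i : {linear P -> P})) => /=.
- by move=> i d f; apply: std_square_homog.
- exact: std_square0.
- by move=> j; rewrite std_squareX add0r.
- by case=> [|[|i]] // j _; rewrite std_squareX addr0.
- by case=> // i _; rewrite std_square_1.
- exact: std_square_cartan.
Defined.

End Existence.

Section Hit.
Variables (n : nat) (Sq : steenrod_action n.+1) (d : nat).
Local Notation k := n.+1.

(* Indices i > d contribute nothing, as g_i would have negative degree. *)
Definition hit (f : {mpoly 'F_2[k]}) : Prop :=
  exists2 g : nat -> {mpoly 'F_2[k]},
    (forall i, (0 < i <= d)%N -> g i \is (d - i).-homog) &
    f = \sum_(1 <= i < d.+1) Sq i (g i).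

(* Sq^(i+1) as a map P_k^(d-(i+1)) -> P_k^d. *)
Definition Sqd (i : 'I_d) (g : dhomog k 'F_2 (d - i.+1)) : dhomog k 'F_2 d :=
  indhomog d (Sq i.+1 (val g)).

Fact val_Sqd i g : val (@Sqd i g) = Sq i.+1 (val g).
Proof.
have := Sq_homog Sq i.+1 (dhomog_is_dhomog g); rewrite subnK //.
exact: insubdK.
Qed.

Fact Sqd_linear i : linear (@Sqd i).
Proof. by move=> a f g; apply: val_inj; rewrite /= !val_Sqd !linearP. Qed.

HB.instance Definition _ (i : 'I_d) :=
  GRing.isLinear.Build 'F_2 _ _ _ (@Sqd i) (@Sqd_linear i).

Definition hit_space : {vspace dhomog k 'F_2 d} :=
  (\sum_(i < d) limg (linfun (@Sqd i)))%VS.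

Lemma hit_spaceP (f : dhomog k 'F_2 d) : f \in hit_space <-> hit (val f).
Proof.
split.
- case/memv_sumP => u u_img ->.
  have u_Sq i : exists g, u i = @Sqd i g.
    have /memv_imgP[g _ ->] := u_img i isT.
    by exists g; rewrite (lfunE (@Sqd i)).
  have [g gP] := fin_all_exists u_Sq.
  exists (fun j => if insub j.-1 is Some i then val (g i) else 0).
    move=> j /andP[j_gt0 le_j_d]; case: insubP => [i _ ij|_]; last exact: dhomog0.
    have -> : j = i.+1 by rewrite -(prednK j_gt0) -ij.
    exact: dhomog_is_dhomog.
  rewrite raddf_sum big_add1 big_mkord /=; apply: eq_bigr => i _.
  have -> : insub (i : nat) = Some i by exact: valK.
  by rewrite gP val_Sqd.
- case=> g ghom fE.
  pose gd (i : 'I_d) : dhomog k 'F_2 (d - i.+1) := indhomog _ (g i.+1).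
  have -> : f = \sum_(i < d) Sqd (gd i).
    apply: val_inj; rewrite fE raddf_sum big_add1 big_mkord /=.
    apply: eq_bigr => i _; rewrite val_Sqd /gd /indhomog insubdK //.
    exact: ghom i.+1 (ltn_ord i).
  apply: memv_sumr => i _.
  by rewrite -(lfunE (@Sqd i)) memv_img ?memvf.
Qed.

(* The degree d component of F_2 (x)_A P_k. *)
Definition QP : vectType 'F_2 := vquot hit_space.

Definition hit_generator (h : dhomog k 'F_2 d) : Prop :=
  exists j (m : 'X_{1..k}),
    [/\ (2 ^ j <= d)%N, mdeg m = (d - 2 ^ j)%N & val h = Sq (2 ^ j)%N 'X_[m]].

Lemma hit_generator_finite :
  exists s : seq (dhomog k 'F_2 d), forall h, h \in s <-> hit_generator h.
Proof.
pose ms j := [seq m <- enum {: 'X_{1..k < d.+1}} | mdeg (bmnm m) == (d - 2 ^ j)%N].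
pose js := [seq j <- iota 0 d | (2 ^ j <= d)%N].
exists [seq indhomog d (Sq (2 ^ j)%N 'X_[bmnm m]) | j <- js, m <- ms j] => h.
have valE j (m : 'X_{1..k}) : (2 ^ j <= d)%N -> mdeg m = (d - 2 ^ j)%N ->
    val (indhomog d (Sq (2 ^ j)%N 'X_[m])) = Sq (2 ^ j)%N 'X_[m].
  move=> le_j_d m_deg; apply: insubdK.
  have mhom : 'X_[m] \is [in 'F_2[k], (d - 2 ^ j).-homog].
    by rewrite dhomogX /= m_deg.
  by have := Sq_homog Sq (2 ^ j)%N mhom; rewrite subnK.
split.
- case/allpairsPdep => j [m [j_js m_ms ->]]; exists j, (bmnm m).
  move: j_js m_ms; rewrite !mem_filter => /andP[le_j_d _] /andP[/eqP m_deg _].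
  by split=> //; apply: valE.
- case=> j [m [le_j_d m_deg hE]]; apply/allpairsPdep.
  have lt_m_d : (mdeg m < d.+1)%N by rewrite m_deg ltnS leq_subr.
  exists j, (BMultinom lt_m_d); split.
  + by rewrite mem_filter le_j_d mem_iota /= (leq_trans (ltn_expl j _) le_j_d).
  + by rewrite mem_filter /= m_deg eqxx mem_enum.
  + by apply: val_inj; rewrite /= valE.
Qed.

End Hit.

Definition nb_monomials (k d : nat) : nat :=
  #|[set m : 'X_{1..k < d.+1} | mdeg m == d]|.

(* Main.v *)
(* The point is that the squares Sq^(2^j) already produce all hit polynomials. *)
(* The total square P(u) = sum_i u^i Sq^i is a ring morphism, so the          *)
(* Bullett-Macdonald identity                                                 *)
(*   P(s^2 + s) P(1) = P(1 + s) P(s^2)                                        *)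
(* holds on P_k as soon as it holds on the variables. In the coefficient of   *)
(* s^i, for 0 < i < n, the part raising degrees by n reads                    *)
(*   C(n, i) Sq^n f \in \sum_(0 < a < n) im Sq^a,                             *)
(* and if n = 2^j m with m > 1 odd then C(n, 2^j) is odd. By induction on n,  *)
(* im Sq^n lies in the sum of the images of the Sq^(2^j). So the space of hit *)
(* polynomials is spanned by the generators, and phi turns its dimension into *)
(* the rank of M.                                                             *)
From HB Require Import structures.
Require Import Defs.
From mathcomp Require Import all_boot all_order all_algebra zify ring.
Import GRing.Theory.
Local Open Scope ring_scope.

(** By [Sq_std] every action is the standard one, so [bullett_macdonald] applies to it. Its graded
    coefficients give [std_square_decomposable]; strong induction ([Sqd_span]) then gives
    [hit_space_span]. Since [phi] is injective and carries the hit space onto the column space of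
    [M], [dim_limg_mulmx] and [dim_vquot] finish the count. *)

Lemma big_antidiagonal (V : nmodType) N n (F : nat -> nat -> V) : (n < N)%N ->
  \sum_(a < N) \sum_(b < N) (if (a + b == n)%N then F a b else 0) =
  \sum_(a < n.+1) F a (n - a)%N.
Proof.
move=> ltnN; rewrite (big_ord_widen _ (fun a => F a (n - a)%N) ltnN).
rewrite [RHS]big_mkcond; apply: eq_bigr => a _; case: ifP => [le_a_n|lt_n_a].
  have ltN : (n - a < N)%N by rewrite (leq_ltn_trans (leq_subr _ _)).
  rewrite (bigD1 (Ordinal ltN)) //= subnKC // eqxx big1 ?addr0 // => b.
  rewrite -val_eqE /= => /negPf neq; case: eqP => // abn.
  by rewrite -abn addKn eqxx in neq.
rewrite big1 // => b _; case: eqP => // abn.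
by rewrite -abn ltnS leq_addr in lt_n_a.
Qed.

Lemma pow2_or_odd_multiple i : (0 < i)%N ->
  (exists j, i = 2 ^ j)%N \/ (exists j m, [/\ i = 2 ^ j * m, odd m & 1 < m]%N).
Proof.
move=> i_gt0; have [m odd_m iE] := pfactor_coprime (isT : prime 2) i_gt0.
move: odd_m; rewrite coprime2n => odd_m.
have [m_le1|m_gt1] := leqP m 1; [left|right].
  exists (logn 2 i); rewrite {1}iE.
  by case: m odd_m m_le1 {iE} => [|[|m]] // _ _; rewrite mul1n.
by exists (logn 2 i), m; rewrite mulnC.
Qed.

(** A case of Lucas: in characteristic 2 the power is [(1 + Y) ^+ m] with [Y = 'X ^+ (2 ^ j)], whose
    linear coefficient in [Y] is [m]. *)
Lemma coef_expr_1DX_pow2 j m :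
  ((1 + 'X) ^+ (2 ^ j * m) : {poly 'F_2})`_(2 ^ j) = m%:R.
Proof.
have char2 : 2%N \in [pchar {poly 'F_2}].
  by rewrite inE /=; apply/eqP; rewrite -polyC_natr pchar_Zp.
rewrite exprM exprDn_pchar ?expr1n; last first.
  rewrite pnatX; apply/orP; left; apply/pnatP => // p p_pr /=.
  by rewrite dvdn_prime2 // => /eqP ->.
elim: m => [|m IHm]; first by rewrite expr0 coef1 expn_eq0.
rewrite exprSr mulrDr mulr1 coefD IHm coefMXn ltnn subnn -horner_coef0.
by rewrite horner_exp !hornerE expr0n expn_eq0 addr0 expr1n natr1.
Qed.

(** In the rank factorization of [M], the row factor has a right inverse, so [M] and its column
    factor have the same image, and the column factor is injective. *)
Lemma dim_limg_mulmx (F : fieldType) m c (M : 'M[F]_(m, c)) :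
  \dim (limg (linfun (mulmx M : 'cV_c -> 'cV_m))) = \rank M.
Proof.
pose B := col_base M.
have -> : limg (linfun (mulmx M : 'cV_c -> 'cV_m)) =
          limg (linfun (mulmx B : 'cV_(\rank M) -> 'cV_m)).
  apply/eqP; rewrite eqEsubv; apply/andP.
  split; apply/subvP => _ /memv_imgP[x _ ->]; rewrite lfunE /=.
    rewrite -[in M *m x](mulmx_base M) -mulmxA -[_ *m _](lfunE (mulmx B)).
    by rewrite memv_img ?memvf.
  have /row_freeP[D DE] := row_base_free M.
  have -> : B *m x = M *m (D *m x).
    by rewrite mulmxA -[B]mulmx1 -DE mulmxA mulmx_base.
  by rewrite -[_ *m _](lfunE (mulmx M)) memv_img ?memvf.
rewrite limg_dim_eq; first by rewrite dimvf dim_matrix [LHS]muln1.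
apply/eqP; rewrite -subv0; apply/subvP => x /memv_capP[_].
rewrite memv_ker lfunE /= => /eqP Bx0.
have /row_fullP[D DE] : row_full B by rewrite col_base_full.
by rewrite -[x]mul1mx -DE -mulmxA Bx0 mulmx0 mem0v.
Qed.

Lemma dim_vquot (K : fieldType) (vT : vectType K) (U : {vspace vT}) :
  \dim {: vquot U} = (\dim {: vT} - \dim U)%N.
Proof. by rewrite dimvf -dimv_compl. Qed.

Lemma val_indhomog (R : nzRingType) k e (p : {mpoly R[k]}) :
  p \is e.-homog -> val (indhomog e p) = p.
Proof. exact: insubdK. Qed.

(** * Total squares with a parameter, and decomposable squares *)

Section TotalSquare.
Variable k : nat.
Local Notation P := {mpoly 'F_2[k]}.
Local Notation lift := (map_poly (@mpolyC k 'F_2)).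

HB.instance Definition _ :=
  GRing.RMorphism.copy (@total_square k)
    (mmap (polyC \o @mpolyC k 'F_2)
       (fun j => ('X_j : P)%:P + ('X_j ^+ 2 : P)%:P * 'X)).

(** The Cartan formula and the values on 1 and on the variables determine the action on
    monomials. *)
Lemma Sq_std (Sq : steenrod_action k) i f : Sq i f = std_square i f.
Proof.
elim/mpolyind: f => [|c m p _ _ IHp]; first by rewrite !linear0.
rewrite !linearP IHp; congr (_ *: _ + _) => {p IHp}.
elim/monomial_ind: m i => [|m j IHm] i.
  rewrite mpolyX0 /= std_square_1; case: i => [|i]; first by rewrite Sq0.
  by rewrite Sq_1.
rewrite mpolyXD Sq_cartan /= std_square_cartan; apply: eq_bigr => a _.
rewrite IHm; congr (_ * _); rewrite std_squareX.
by case: (val a) => [|[|b]]; rewrite ?Sq0 ?Sq1X ?SqX //= ?addr0 ?add0r.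
Qed.

(* With T = P(u) the total square at parameter u, [square_at u] is T on P_k,  *)
(* and [poly_square_at u] is its extension to P_k[X] fixing X.                *)
Definition square_at (u : {poly P}) : P -> {poly P} :=
  horner_eval u \o map_poly polyC \o @total_square k.

HB.instance Definition _ u := GRing.RMorphism.on (square_at u).

Definition poly_square_at (u : {poly P}) : {poly P} -> {poly P} :=
  horner_eval 'X \o map_poly (square_at u).

HB.instance Definition _ u := GRing.RMorphism.on (poly_square_at u).

Lemma square_atX u j : square_at u 'X_j = ('X_j)%:P + ('X_j ^+ 2)%:P * u.
Proof.
rewrite /square_at /= total_squareX rmorphD rmorphM /= !map_polyC map_polyX.
by rewrite /horner_eval !hornerE.
Qed.

Lemma poly_square_atC u f : poly_square_at u f%:P = square_at u f.
Proof. by rewrite /poly_square_at /= map_polyC /horner_eval hornerC. Qed.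

Lemma poly_square_atX u : poly_square_at u 'X = 'X.
Proof. by rewrite /poly_square_at /= map_polyX /horner_eval hornerX. Qed.

Lemma square_atE u f N : (size (@total_square k f) <= N)%N ->
  square_at u f = \sum_(a < N) (std_square a f)%:P * u ^+ a.
Proof.
move=> leN; rewrite /square_at /= /horner_eval (horner_coef_wide _ (n := N)).
  by apply: eq_bigr => a _; rewrite coef_map.
exact: leq_trans (size_poly _ _) leN.
Qed.

(** Elements of F_2 are images of natural numbers, so ring morphisms automatically agree on
    constants. *)
Lemma F2_rmorphism_ext (R : comNzRingType) (F G : {rmorphism P -> R}) :
  (forall j, F 'X_j = G 'X_j) -> F =1 G.
Proof.
move=> FG f; rewrite [f]mpolyE !rmorph_sum; apply: eq_bigr => m _.
rewrite -mul_mpolyC -[f@_m]natr_Zp !rmorphM !rmorph_nat; congr (_ * _).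
elim/monomial_ind: m => [|m j IHm]; first by rewrite mpolyX0 !rmorph1.
by rewrite mpolyXD !rmorphM /= FG IHm.
Qed.

Lemma pchar_poly_mpoly : 2%N \in [pchar {poly P}].
Proof.
by rewrite inE /=; apply/eqP; rewrite -polyC_natr -mpolyC_nat pchar_Zp.
Qed.

(* The Bullett-Macdonald identity P(s^2 + s t) P(t^2) = P(t^2 + s t) P(s^2),  *)
(* which encodes the Adem relations, at s = 'X and t = 1.                     *)
Lemma bullett_macdonald f :
  poly_square_at ('X ^+ 2 + 'X) (square_at 1 f) =
  poly_square_at (1 + 'X) (square_at ('X ^+ 2) f).
Proof.
apply: (F2_rmorphism_ext _ (poly_square_at ('X ^+ 2 + 'X) \o square_at 1)
  (poly_square_at (1 + 'X) \o square_at ('X ^+ 2))) => j /=.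
rewrite !square_atX !rmorphD !rmorphM !rmorph1 /= !poly_square_atX.
rewrite !poly_square_atC !square_atX !rmorphXn /=; set x := _%:P.
pose y := x + x ^+ 2 * (1 + 'X).
(* The two sides differ by an even multiple of [x ^+ 3], made explicit so that [ring] applies before
   characteristic 2 removes it. *)
rewrite [LHS](_ : _ = y + y ^+ 2 * 'X ^+ 2 + 2%:R * (x ^+ 3 * ('X - 'X ^+ 3))).
  by rewrite (pcharf0 pchar_poly_mpoly) mul0r addr0 /y; ring.
by rewrite /y; ring.
Qed.

(** Only finitely many [b] give a nonzero [std_square b f]; a uniform bound turns composites of
    total squares into finite double sums. *)
Lemma std_square_bound f : exists N, forall b,
  (size (total_square (std_square b f) : {poly P}) <= N)%N.
Proof.
pose K := size (total_square f : {poly P}).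
pose F b := size (total_square (std_square b f) : {poly P}).
have F0 b : (K <= b)%N -> F b = 0%N.
  move=> le_Kb; rewrite /F /std_square [X in total_square X]nth_default //.
  by rewrite (rmorph0 (@total_square k)) size_poly0.
change (exists N, forall b, F b <= N)%N; clearbody F K.
exists (\max_(b < K) F b) => b; have [le_Kb|lt_bK] := leqP K b.
  by rewrite F0.
exact: (leq_bigmax (Ordinal lt_bK)).
Qed.

(** The inner parameter must be fixed by the outer operation, as are polynomials in ['X] over
    F_2. *)
Lemma poly_square_atE u v f N : poly_square_at u v = v ->
    (forall b, size (@total_square k (std_square b f)) <= N)%N ->
  poly_square_at u (square_at v f) =
  \sum_(a < N) \sum_(b < N)
    (std_square a (std_square b f))%:P * (u ^+ a * v ^+ b).
Proof.
move=> uv leN; have := leN 0%N; rewrite std_square0 => leN0.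
rewrite (square_atE v _ _ leN0).
rewrite rmorph_sum exchange_big; apply: eq_bigr => b _.
rewrite rmorphM rmorphXn /= uv poly_square_atC (square_atE _ _ _ (leN b)).
by rewrite big_distrl; apply: eq_bigr => a _; rewrite mulrA.
Qed.

Lemma coef_scalar_mul (g : P) (w : {poly 'F_2}) i :
  (g%:P * lift w)`_i = w`_i *: g.
Proof. by rewrite coefCM coef_map mulrC -mul_mpolyC. Qed.

Lemma pihomog_std_square e n a b (f : P) : f \is e.-homog ->
  pihomog mdeg (e + n) (std_square a (std_square b f)) =
  if (a + b == n)%N then std_square a (std_square b f) else 0.
Proof.
move=> /(std_square_homog b)/(std_square_homog a) homf.
case: eqP => [abn|/eqP abn].
  by rewrite pihomog_dE // -abn [(a + b)%N]addnC addnA.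
by rewrite (pihomog_ne0 _ homf) // -addnA eqn_add2l addnC.
Qed.

Lemma coef_poly_square_at (u v : {poly 'F_2}) i e n (f : P) :
    poly_square_at (lift u) (lift v) = lift v -> f \is e.-homog ->
  pihomog mdeg (e + n) (poly_square_at (lift u) (square_at (lift v) f))`_i =
  \sum_(a < n.+1)
    (u ^+ a * v ^+ (n - a))`_i *: std_square a (std_square (n - a) f).
Proof.
move=> uv homf; have [N leN] := std_square_bound f.
have {}leN b : (size (@total_square k (std_square b f)) <= maxn N n.+1)%N.
  by rewrite (leq_trans (leN b)) ?leq_maxl.
rewrite (poly_square_atE _ _ _ _ uv leN) coef_sum linear_sum.
have ltn : (n < maxn N n.+1)%N by rewrite leq_maxr.
rewrite -(big_antidiagonal _ _ _ (fun a b =>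
   (u ^+ a * v ^+ b)`_i *: std_square a (std_square b f)) ltn).
apply: eq_bigr => a _; rewrite coef_sum linear_sum; apply: eq_bigr => b _ /=.
rewrite -!rmorphXn -rmorphM /= coef_scalar_mul linearZ /=.
by rewrite (pihomog_std_square _ _ _ _ _ homf); case: ifP; rewrite ?scaler0.
Qed.

Lemma std_square_decomposable n i e (f : P) :
    (0 < i < n)%N -> ((1 + 'X) ^+ n : {poly 'F_2})`_i = 1 -> f \is e.-homog ->
  exists c : nat -> 'F_2,
    std_square n f =
      \sum_(1 <= a < n) c a *: std_square a (std_square (n - a) f).
Proof.
move=> /andP[i_gt0 lt_i_n] coef_eq1 homf.
pose A a : 'F_2 := (('X ^+ 2 + 'X) ^+ a)`_i.
pose B a : 'F_2 := ((1 + 'X) ^+ a * 'X ^+ 2 ^+ (n - a))`_i.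
pose T a := std_square a (std_square (n - a) f).
(* [A] and [B] are the coefficients of [T a] on the two sides of the identity. At the ends [a = 0]
   and [a = n] only [B n = 1] survives, which isolates [T n], the square to be decomposed. *)
exists (fun a => A a - B a).
have BM : \sum_(0 <= a < n.+1) A a *: T a = \sum_(0 <= a < n.+1) B a *: T a.
  have := congr1 (fun p : {poly P} => pihomog mdeg (e + n) p`_i)
    (bullett_macdonald f).
  have E1 : (1 : {poly P}) = lift 1 by rewrite rmorph1.
  have EX : ('X : {poly P}) = lift 'X by rewrite map_polyX.
  rewrite E1 EX -!rmorphXn -!rmorphD /=.
  rewrite !(@coef_poly_square_at _ _ _ e) // ?rmorph1 //; last first.
    by rewrite rmorphXn /= map_polyX rmorphXn /= poly_square_atX.
  rewrite !big_mkord => EQ; rewrite -[RHS]EQ.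
  by apply: eq_bigr => a _; rewrite expr1n mulr1.
have n_gt0 : (0 < n)%N by apply: leq_trans lt_i_n.
have An : A n = 0.
  rewrite /A (_ : 'X ^+ 2 + 'X = ('X + 1) * 'X :> {poly 'F_2}); last by ring.
  by rewrite exprMn coefMXn lt_i_n.
have Bn : B n = 1 by rewrite /B subnn expr0 mulr1.
have A0 : A 0%N = 0 by rewrite /A expr0 coef1 gtn_eqF.
have B0 : B 0%N = 0.
  rewrite /B expr0 mul1r subn0 -exprM coefXn ltn_eqF //.
  by rewrite mul2n -addnn ltn_addr.
move: BM; rewrite !(big_ltn (ltn0Sn n)) A0 B0 !scale0r !add0r.
rewrite !big_nat_recr //= An Bn scale0r scale1r addr0 /T subnn std_square0.
move=> BM; under eq_bigr => a _ do rewrite scalerBl.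
by rewrite sumrB BM addrAC subrr add0r.
Qed.

End TotalSquare.

(** * Spanning the hit space by the generators *)

Section HitSpace.
Variables (n d : nat) (Sq : steenrod_action n.+1).
Local Notation k := n.+1.

Lemma Sq_decomposable a (f : {mpoly 'F_2[k]}) e j m : f \is e.-homog ->
    a = (2 ^ j * m)%N -> odd m -> (1 < m)%N ->
  exists c : nat -> 'F_2,
    Sq a f = \sum_(1 <= b < a) c b *: Sq b (Sq (a - b)%N f).
Proof.
move=> homf aE odd_m m_gt1.
have m1 : (m%:R : 'F_2) = 1.
  by apply/val_inj; rewrite /= val_Fp_nat // modn2 odd_m.
have coef_eq1 : ((1 + 'X) ^+ a : {poly 'F_2})`_(2 ^ j) = 1.
  by rewrite aE coef_expr_1DX_pow2.
have lt_ja : (0 < 2 ^ j < a)%N by rewrite aE expn_gt0 ltn_Pmulr ?expn_gt0.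
have [c cE] := std_square_decomposable _ _ _ _ _ lt_ja coef_eq1 homf.
by exists c; rewrite Sq_std cE; apply: eq_bigr => b _; rewrite !Sq_std.
Qed.

Lemma Sqd_span (s : seq (dhomog k 'F_2 d)) :
    (forall h, hit_generator Sq h -> h \in s) ->
  forall i g, Sqd Sq (i := i : 'I_d) g \in <<s>>%VS.
Proof.
move=> gens [i lt_i_d]; elim/ltn_ind: i lt_i_d => i IH lt_i_d g.
have [[j iE]|[j [m [iE odd_m m_gt1]]]] := pow2_or_odd_multiple _ (ltn0Sn i).
  have gE : g = \sum_(m <- msupp (val g)) (val g)@_m *: indhomog _ 'X_[m].
    apply: val_inj; rewrite [LHS]mpolyE linear_sum big_seq [RHS]big_seq.
    apply: eq_bigr => m /(dhomog_mf (dhomog_is_dhomog g)) mdeg_m /=.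
    by rewrite val_indhomog // dhomogX mdeg_m.
  rewrite gE linear_sum big_seq memv_suml // => m m_g.
  have mdeg_m := dhomog_mf (dhomog_is_dhomog g) m_g.
  rewrite linearZ memvZ // memv_span //; apply: gens; exists j, m.
  split; rewrite -?iE //.
  by rewrite val_Sqd val_indhomog // dhomogX mdeg_m.
have [c cE] := Sq_decomposable _ _ _ _ _ (dhomog_is_dhomog g) iE odd_m m_gt1.
(* Only the outer square matters: the inner one is absorbed into its argument. As [Sqd] at [b] is
   the square of index [b.+1], the inner index is [i - b]. *)
suff -> : Sqd Sq (i := Ordinal lt_i_d) g = \sum_(b < i) c b.+1 *:
  Sqd Sq (i := Ordinal (ltn_trans (ltn_ord b) lt_i_d))
    (indhomog _ (Sq (i - b)%N (val g))).
  by apply: memv_suml => b _; rewrite memvZ // IH.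
apply: val_inj; rewrite val_Sqd cE big_add1 big_mkord /= linear_sum.
apply: eq_bigr => b _; rewrite linearZ /= val_Sqd subSS val_indhomog //.
have := Sq_homog Sq (i - b)%N (dhomog_is_dhomog g).
rewrite (_ : d - (val (Ordinal lt_i_d)).+1 + (i - b) = d - b.+1)%N //=.
by have := ltn_ord b; lia.
Qed.

Lemma hit_space_span (s : seq (dhomog k 'F_2 d)) :
  (forall h, h \in s <-> hit_generator Sq h) -> hit_space Sq d = <<s>>%VS.
Proof.
move=> sP; apply/eqP; rewrite eqEsubv; apply/andP; split.
  apply/subv_sumP => i _; apply/subvP => _ /memv_imgP[g _ ->].
  by rewrite lfunE; apply: Sqd_span => h /sP.
apply/span_subvP => h /sP[j [m [le_j_d mdeg_m hE]]].
apply/hit_spaceP; exists (fun i => 'X_[m] *+ (i == 2 ^ j)%N).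
  move=> i _; case: eqP => [->|_]; last exact: dhomog0.
  by rewrite mulr1n dhomogX /= mdeg_m.
have lt : (2 ^ j - 1 < d)%N by have := expn_gt0 2 j; lia.
rewrite hE (bigD1_seq (2 ^ j)%N) ?mem_index_iota ?iota_uniq ?expn_gt0 //=.
rewrite eqxx big1 ?addr0 // => i /negPf ->; exact: linear0.
Qed.

End HitSpace.

Theorem corollary2p5 (n d : nat) (Sq : steenrod_action n.+1)
    (phi : {linear dhomog n.+1 'F_2 d -> 'cV['F_2]_(nb_monomials n.+1 d)})
    (phi_bij : bijective phi)
    (c : nat) (M : 'M['F_2]_(nb_monomials n.+1 d, c))
    (col_M : forall v : 'cV['F_2]_(nb_monomials n.+1 d),
       (exists j, col j M = v) <-> (exists2 h, hit_generator Sq h & phi h = v)) :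
  (\dim {: QP Sq d})%:Z
  = 'C(d + n.+1 - 1, n.+1 - 1)%:Z - (\rank M)%:Z.
Proof.
have [s sP] := hit_generator_finite Sq d.
have dimH : \dim (hit_space Sq d) = \rank M.
  rewrite (hit_space_span _ _ _ _ sP) -dim_limg_mulmx.
  rewrite -(@limg_dim_eq _ _ _ (linfun phi)); last first.
    apply/eqP; rewrite -subv0; apply/subvP => x /memv_capP[_].
    rewrite memv_ker lfunE /= -(linear0 phi) => /eqP/(bij_inj phi_bij) ->.
    exact: mem0v.
  (* The image under [phi] of the span of the generators is the column space of [M]. *)
  congr (\dim _); apply/eqP; rewrite eqEsubv; apply/andP; split.
    rewrite limg_span; apply/span_subvP => _ /mapP[h /sP h_gen ->].
    have [j <-] : exists j, col j M = linfun phi h.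
      by apply/col_M; exists h => //; rewrite lfunE.
    by rewrite colE -[_ *m _](lfunE (mulmx M)) memv_img ?memvf.
  apply/subvP => _ /memv_imgP[x _ ->]; rewrite lfunE /=.
  have -> : M *m x = \sum_j x j 0 *: col j M.
    apply/colP => i; rewrite mxE summxE; apply: eq_bigr => j _.
    by rewrite !mxE mulrC.
  apply: memv_suml => j _; rewrite memvZ //.
  have [h h_gen <-] : exists2 h, hit_generator Sq h & phi h = col j M.
    by apply/col_M; exists j.
  by rewrite -[phi h](lfunE phi) memv_img // memv_span //; apply/sP.
have dimP : \dim {: dhomog n.+1 'F_2 d} = 'C(d + n, n).
  by rewrite dimvf -(bin_sub (leq_addl d n)) addnK.
have -> : \dim {: QP Sq d} =
    (\dim {: dhomog n.+1 'F_2 d} - \dim (hit_space Sq d))%N.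
  exact: dim_vquot.
rewrite dimP dimH addnS !subn1 /= subzn //.
(* The natural subtraction agrees with the integer one because the rank is the dimension of a
   subspace. *)
by rewrite -dimH -dimP dimvS // subvf.
Qed.
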